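(* Let $\mathbb{K}=\mathbb{R}$ or $\mathbb{C}$. There is a one-to-one correspondence between representations of the Lie antialgebra $\mathrm{asl}_2(\mathbb{K})$ and representations of the Lie superalgebra $\mathrm{osp}(1|2)$ such that $$\Gamma^2=\tfrac14\,\mathrm{Id},$$ where $\Gamma=AB-BA-\tfrac12\,\mathrm{Id}$ is the action of the ghost Casimir element of $\mathcal{U}(\mathrm{osp}(1|2))$. The correspondence is the following: on a given $\mathbb{Z}_2$-graded vector space $V$, the $\mathrm{asl}_2(\mathbb{K})$-representation $\chi$ corresponds to the $\mathrm{osp}(1|2)$-representation in which the odd generators act by $A=2\chi_a$, $B=2\chi_b$ and the even generators act by $E=A^2$, $F=-B^2$, $H=-(AB+BA)$.
   Context: The Lie antialgebra $\mathrm{asl}_2(\mathbb{K})$ is the $\mathbb{Z}_2$-graded $\mathbb{K}$-vector space with even part spanned by $\varepsilon$ and odd part spanned by $a,b$, with the bilinear product $\varepsilon\cdot\varepsilon=\varepsilon$, $\varepsilon\cdot a=a\cdot\varepsilon=\tfrac12 a$, $\varepsilon\cdot b=b\cdot\varepsilon=\tfrac12 b$, $a\cdot b=-b\cdot a=\tfrac12\varepsilon$, and $a\cdot a=b\cdot b=0$. A representation of $\mathrm{asl}_2(\mathbb{K})$ is a pair $(V,\chi)$ with $V=V_0\oplus V_1$ a $\mathbb{Z}_2$-graded $\mathbb{K}$-vector space (possibly infinite-dimensional) and $\chi:\mathrm{asl}_2(\mathbb{K})\to\mathrm{End}(V)$ an even (parity-preserving) linear map such that $\chi_x\chi_y+(-1)^{p(x)p(y)}\chi_y\chi_x=\chi_{x\cdot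 y}$ for all homogeneous $x,y$, where $p$ denotes parity. $\mathrm{osp}(1|2)$ is the Lie superalgebra over $\mathbb{K}$ with even basis $E,F,H$ and odd basis $A,B$ and (super)brackets $[H,E]=2E$, $[H,F]=-2F$, $[E,F]=H$, $[H,A]=A$, $[H,B]=-B$, $[E,A]=0$, $[E,B]=A$, $[F,A]=B$, $[F,B]=0$, $[A,A]=2E$, $[B,B]=-2F$, $[A,B]=-H$. A representation of $\mathrm{osp}(1|2)$ is a $\mathbb{Z}_2$-graded vector space with a parity-preserving homomorphism of Lie superalgebras to $\mathrm{End}(V)$ equipped with the supercommutator $[X,Y]=XY-(-1)^{p(X)p(Y)}YX$. The ghost Casimir element of $\mathcal{U}(\mathrm{osp}(1|2))$ is $AB-BA-\tfrac12$. *)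

(* Defs.v *)
From HB Require Import structures.
From mathcomp Require Import all_boot all_order all_algebra.
From mathcomp Require Import reals.
From mathcomp.real_closed Require Import complex.

Set Implicit Arguments.
Unset Strict Implicit.
Unset Printing Implicit Defensive.

Import GRing.Theory.
Local Open Scope ring_scope.

Inductive scalars := Reals | Complexes.

Definition ground (R : realType) (k : scalars) : fieldType :=
  if k is Reals then R else R[i].

(* Parities are booleans, true meaning odd.  A finite-dimensional graded algebra
   is given by a finite basis I, a parity I -> bool, and the products of basis
   vectors; its elements are the coordinate vectors {ffun I -> K^o}. *)

Definition basis_vec (K : fieldType) (I : finType) (i : I) : {ffun I -> K^o} :=
  [ffun j => (j == i)%:R].

Definition bilinear_extension (K : fieldType) (I : finType)
    (table : I -> I -> {ffun I -> K^o}) (x y : {ffun I -> K^o}) :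
    {ffun I -> K^o} :=
  \sum_i \sum_j (x i * y j) *: table i j.

(* The zero vector is homogeneous of both parities. *)
Definition homogeneous (K : fieldType) (I : finType) (parity : I -> bool)
    (p : bool) (x : {ffun I -> K^o}) : Prop :=
  forall i, x i != 0 -> parity i = p.

Inductive asl2_basis := asl_eps | asl_a | asl_b.

Definition asl2_basis_code (i : asl2_basis) : nat :=
  match i with asl_eps => 0 | asl_a => 1 | asl_b => 2 end.
Definition asl2_basis_decode (n : nat) : asl2_basis :=
  match n with 0 => asl_eps | 1 => asl_a | _ => asl_b end.
Fact asl2_basis_codeK : cancel asl2_basis_code asl2_basis_decode.
Proof. by case. Qed.
HB.instance Definition _ :=
  Countable.copy asl2_basis (can_type asl2_basis_codeK).
Fact asl2_basis_enumP : Finite.axiom [:: asl_eps; asl_a; asl_b].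
Proof. by case. Qed.
HB.instance Definition _ := isFinite.Build asl2_basis asl2_basis_enumP.

Definition asl2_parity (i : asl2_basis) : bool :=
  if i is asl_eps then false else true.

Definition asl2 (K : fieldType) := {ffun asl2_basis -> K^o}.

Definition asl2_table (K : fieldType) (i j : asl2_basis) : asl2 K :=
  let e := @basis_vec K asl2_basis in
  match i, j with
  | asl_eps, asl_eps => e asl_eps
  | asl_eps, asl_a | asl_a, asl_eps => 2^-1 *: e asl_a
  | asl_eps, asl_b | asl_b, asl_eps => 2^-1 *: e asl_b
  | asl_a, asl_b => 2^-1 *: e asl_eps
  | asl_b, asl_a => - (2^-1 *: e asl_eps)
  | asl_a, asl_a | asl_b, asl_b => 0
  end.

Definition asl2_mul (K : fieldType) : asl2 K -> asl2 K -> asl2 K :=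
  bilinear_extension (@asl2_table K).

Inductive osp_basis := osp_E | osp_F | osp_H | osp_A | osp_B.

Definition osp_basis_code (i : osp_basis) : nat :=
  match i with
  | osp_E => 0 | osp_F => 1 | osp_H => 2 | osp_A => 3 | osp_B => 4
  end.
Definition osp_basis_decode (n : nat) : osp_basis :=
  match n with
  | 0 => osp_E | 1 => osp_F | 2 => osp_H | 3 => osp_A | _ => osp_B
  end.
Fact osp_basis_codeK : cancel osp_basis_code osp_basis_decode.
Proof. by case. Qed.
HB.instance Definition _ :=
  Countable.copy osp_basis (can_type osp_basis_codeK).
Fact osp_basis_enumP : Finite.axiom [:: osp_E; osp_F; osp_H; osp_A; osp_B].
Proof. by case. Qed.
HB.instance Definition _ := isFinite.Build osp_basis osp_basis_enumP.

Definition osp_parity (i : osp_basis) : bool :=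
  match i with osp_A | osp_B => true | _ => false end.

Definition osp (K : fieldType) := {ffun osp_basis -> K^o}.

(* The products in the opposite order follow from super-antisymmetry,
   [y, x] = - (-1)^(p(x)p(y)) [x, y]. *)
Definition osp_table (K : fieldType) (i j : osp_basis) : osp K :=
  let e := @basis_vec K osp_basis in
  match i, j with
  | osp_H, osp_E => 2 *: e osp_E     | osp_E, osp_H => - (2 *: e osp_E)
  | osp_H, osp_F => - (2 *: e osp_F) | osp_F, osp_H => 2 *: e osp_F
  | osp_E, osp_F => e osp_H          | osp_F, osp_E => - e osp_H
  | osp_H, osp_A => e osp_A          | osp_A, osp_H => - e osp_A
  | osp_H, osp_B => - e osp_B        | osp_B, osp_H => e osp_B
  | osp_E, osp_A => 0                | osp_A, osp_E => 0
  | osp_E, osp_B => e osp_A          | osp_B, osp_E => - e osp_A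
  | osp_F, osp_A => e osp_B          | osp_A, osp_F => - e osp_B
  | osp_F, osp_B => 0                | osp_B, osp_F => 0
  | osp_A, osp_A => 2 *: e osp_E
  | osp_B, osp_B => - (2 *: e osp_F)
  | osp_A, osp_B => - e osp_H        | osp_B, osp_A => - e osp_H
  | osp_E, osp_E | osp_F, osp_F | osp_H, osp_H => 0
  end.

Definition osp_bracket (K : fieldType) : osp K -> osp K -> osp K :=
  bilinear_extension (@osp_table K).

(* A graded space V = V0 (+) V1 is the product V0 * V1 of its components, and
   its endomorphisms are the linear maps of V0 * V1 to itself. *)
Definition in_component (K : fieldType) (V0 V1 : lmodType K) (p : bool)
    (v : (V0 * V1)%type) : Prop :=
  if p then v.1 = 0 else v.2 = 0.

(* An endomorphism of parity p shifts the grading by p. *)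
Definition homogeneous_end (K : fieldType) (V0 V1 : lmodType K) (p : bool)
    (f : {linear (V0 * V1)%type -> (V0 * V1)%type}) : Prop :=
  forall q v, in_component q v -> in_component (p (+) q) (f v).

Record asl2_rep (K : fieldType) (V0 V1 : lmodType K) := Asl2Rep {
  asl2_act :> asl2 K -> {linear (V0 * V1)%type -> (V0 * V1)%type};
  asl2_act_linear : forall v, linear (fun x => asl2_act x v);
  asl2_act_even : forall p x,
    homogeneous asl2_parity p x -> homogeneous_end p (asl2_act x);
  asl2_act_mul : forall p q x y,
    homogeneous asl2_parity p x -> homogeneous asl2_parity q y ->
    forall v, asl2_act x (asl2_act y v)
              + (-1) ^+ (p && q) *: asl2_act y (asl2_act x v)
              = asl2_act (asl2_mul x y) v
}.

Record osp_rep (K : fieldType) (V0 V1 : lmodType K) := OspRep {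
  osp_act :> osp K -> {linear (V0 * V1)%type -> (V0 * V1)%type};
  osp_act_linear : forall v, linear (fun x => osp_act x v);
  osp_act_even : forall p x,
    homogeneous osp_parity p x -> homogeneous_end p (osp_act x);
  osp_act_bracket : forall p q x y,
    homogeneous osp_parity p x -> homogeneous osp_parity q y ->
    forall v, osp_act (osp_bracket x y) v
              = osp_act x (osp_act y v)
                - (-1) ^+ (p && q) *: osp_act y (osp_act x v)
}.

Definition asl2_gen (K : fieldType) (V0 V1 : lmodType K)
    (chi : asl2_rep V0 V1) (i : asl2_basis) :
    {linear (V0 * V1)%type -> (V0 * V1)%type} :=
  chi (basis_vec K i).

Definition osp_gen (K : fieldType) (V0 V1 : lmodType K)
    (rho : osp_rep V0 V1) (i : osp_basis) :
    {linear (V0 * V1)%type -> (V0 * V1)%type} :=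
  rho (basis_vec K i).

Definition ghost_casimir (K : fieldType) (V0 V1 : lmodType K)
    (rho : osp_rep V0 V1) (v : (V0 * V1)%type) : (V0 * V1)%type :=
  let A := osp_gen rho osp_A in
  let B := osp_gen rho osp_B in
  A (B v) - B (A v) - 2^-1 *: v.

Definition ghost_osp_rep (K : fieldType) (V0 V1 : lmodType K) :=
  {rho : osp_rep V0 V1 |
    forall v, ghost_casimir rho (ghost_casimir rho v) = 4^-1 *: v}.

(* Main.v *)
(* With P := AB - BA, the asl2 relations for eps = P/2, a = A/2, b = B/2 read
   P P = P, A P + P A = A and B P + P B = B.  The last two unfold to
   [A^2, B] = A and [A, B^2] = B, the cubic relations on A and B that imply all
   of osp(1|2) for E = A^2, F = -B^2, H = -(AB + BA); and the first one is
   Gamma^2 = 1/4 for Gamma = P - 1/2. *)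

Require Import Defs.
From HB Require Import structures.
From mathcomp Require Import all_boot all_order all_algebra.
From mathcomp Require Import boolp reals.
From mathcomp.real_closed Require Import complex.

Set Implicit Arguments.
Unset Strict Implicit.
Unset Printing Implicit Defensive.

Import GRing.Theory Num.Theory.
Local Open Scope ring_scope.

(** A bundled linear map is a function together with proofs, so function extensionality and proof
    irrelevance suffice. Bijectivity is stated with Leibniz equality of representations, which rests
    on this. *)
Lemma linear_ext (K : fieldType) (U V : lmodType K) (f g : {linear U -> V}) :
  f =1 g -> f = g.
Proof.
move: f g => [f cf] [g cg] /= /funext fg; move: cf cg; rewrite {f}fg => cf cg.
congr GRing.Linear.Pack.
by case: cf cg => [[a] [b]] [[a'] [b']]; congr (GRing.Linear.Class _ _);
  congr (_ _); apply: Prop_irrelevance.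
Qed.

(** * Linear extension of a family of endomorphisms indexed by a basis *)

Section Combine.
Variables (K : fieldType) (I : finType) (V : lmodType K).
Implicit Types (g : I -> {linear V -> V}) (x y : {ffun I -> K^o}).

Definition combine g x (v : V) : V := \sum_i (x i : K) *: g i v.

Fact combine_is_linear g x : linear (combine g x).
Proof.
move=> c u v; rewrite /combine scaler_sumr -big_split /=.
apply: eq_bigr => i _.
by rewrite linearP scalerDr !scalerA mulrC.
Qed.

HB.instance Definition _ g x :=
  GRing.isLinear.Build K V V *:%R (combine g x) (combine_is_linear g x).

Lemma combine_linear g v : linear (fun x => combine g x v).
Proof.
move=> c x y; rewrite /combine scaler_sumr -big_split /=.
by apply: eq_bigr => i _; rewrite !ffunE scalerA -scalerDl.
Qed.

Lemma combine0 g v : combine g 0 v = 0.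
Proof. by rewrite /combine big1 // => i _; rewrite ffunE scale0r. Qed.

Lemma combineZ g c x v : combine g (c *: x) v = c *: combine g x v.
Proof. by have := combine_linear g v c x 0; rewrite combine0 !addr0. Qed.

Lemma combineN g x v : combine g (- x) v = - combine g x v.
Proof. by rewrite -[- x]scaleN1r combineZ scaleN1r. Qed.

Lemma combine_basis g i v : combine g (basis_vec K i) v = g i v.
Proof.
rewrite /combine (bigD1 i) //= big1 => [|j /negbTE ji].
  by rewrite ffunE eqxx scale1r addr0.
by rewrite ffunE ji scale0r.
Qed.

Lemma combine_sum g (J : finType) (F : J -> {ffun I -> K^o}) v :
  combine g (\sum_j F j) v = \sum_j combine g (F j) v.
Proof.
apply: (big_ind2 (fun x u => combine g x v = u)) => [|x1 u1 x2 u2 <- <-|//].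
  exact: combine0.
by have := combine_linear g v 1 x1 x2; rewrite !scale1r.
Qed.

(** Expanding [x] in the basis shows that a linear action is determined by its generators. *)
Lemma linear_combine (f : {ffun I -> K^o} -> {linear V -> V}) x v :
    (forall v, linear (fun x => f x v)) ->
  f x v = combine (fun i => f (basis_vec K i)) x v.
Proof.
move=> fl.
pose h := HB.pack_for {linear {ffun I -> K^o} -> V} (fun x => f x v)
  (GRing.isLinear.Build K _ _ *:%R _ (fl v)).
have -> : x = \sum_i (x i : K) *: basis_vec K i.
  apply/ffunP => j; rewrite sum_ffunE (bigD1 j) //= big1 => [|i /negbTE ij].
    by rewrite !ffunE eqxx /= addr0 [_ *: _]mulr1.
  by rewrite !ffunE eq_sym ij [_ *: _]mulr0.
rewrite -[LHS]/(h _) linear_sum combine_sum; apply: eq_bigr => i _.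

by rewrite linearZ combineZ combine_basis.
Qed.

Lemma combine_comp g x y v :
  combine g x (combine g y v) = \sum_i \sum_j (x i * y j : K) *: g i (g j v).
Proof.
rewrite {1}/combine; apply: eq_bigr => i _.
rewrite /combine linear_sum scaler_sumr; apply: eq_bigr => j _.
by rewrite linearZ scalerA.
Qed.

(** Reduces the axiom on homogeneous elements to basis vectors. Only indices with nonzero
    coefficients contribute, and these have parities [p] and [q], so the sign is the same in all
    terms. The antialgebra is the case [c = 1], the superalgebra [c = -1]. *)
Lemma combine_table g (parity : I -> bool) table (c : K) :
    (forall i j v, combine g (table i j) v =
       g i (g j v) + (c * (-1) ^+ (parity i && parity j)) *: g j (g i v)) ->
  forall p q x y, homogeneous parity p x -> homogeneous parity q y ->
  forall v, combine g (bilinear_extension table x y) v =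
    combine g x (combine g y v)
    + (c * (-1) ^+ (p && q)) *: combine g y (combine g x v).
Proof.
move=> gt p q x y hx hy v; rewrite /bilinear_extension !combine_comp.
(* Swapping the sums of the opposite product lets both sides be compared term by term. *)
rewrite [in X in _ = _ + _ *: X]exchange_big scaler_sumr -big_split combine_sum.
apply: eq_bigr => i _; rewrite scaler_sumr -big_split combine_sum.
apply: eq_bigr => j _ /=; rewrite combineZ gt scalerDr !scalerA.
have [->|/hx ->] := eqVneq (x i) 0; first by rewrite !(mul0r, mulr0) !scale0r.
have [->|/hy ->] := eqVneq (y j) 0; first by rewrite !(mul0r, mulr0) !scale0r.
by rewrite [y j * _]mulrC [_ * (x i * _)]mulrC.
Qed.

Lemma bilinear_extension_basis (table : I -> I -> {ffun I -> K^o}) i j :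
  bilinear_extension table (basis_vec K i) (basis_vec K j) = table i j.
Proof.
rewrite /bilinear_extension (bigD1 i) //= [X in _ + X]big1; last first.
  move=> k /negbTE ki.
  by apply: big1 => l _; rewrite ffunE ki mul0r scale0r.
rewrite addr0 (bigD1 j) //= [X in _ + X]big1 => [|k /negbTE kj]; last first.
  by rewrite [basis_vec K j k]ffunE kj mulr0 scale0r.
by rewrite !ffunE !eqxx mulr1 scale1r addr0.
Qed.

End Combine.

(** * Parity of endomorphisms of a graded space *)

Section Homogeneous.
Variables (K : fieldType) (V0 V1 : lmodType K).
Let V : lmodType K := (V0 * V1)%type.

Lemma in_componentD p (u v : V) :
  in_component p u -> in_component p v -> in_component p (u + v).
Proof. by case: p => /= -> ->; rewrite addr0. Qed.

Lemma in_componentZ p c (v : V) : in_component p v -> in_component p (c *: v).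
Proof. by case: p => /= ->; rewrite scaler0. Qed.

(** The map [h] is tied to the composite only pointwise, so the lemma applies whichever linear
    structure [h] carries. *)
Lemma homogeneous_end_comp p q (f g h : {linear V -> V}) :
  homogeneous_end p f -> homogeneous_end q g -> h =1 f \o g ->
  homogeneous_end (p (+) q) h.
Proof. by move=> hf hg hE r v /hg/hf; rewrite hE addbA. Qed.

Lemma homogeneous_endD p (f g h : {linear V -> V}) :
  homogeneous_end p f -> homogeneous_end p g -> h =1 f \+ g ->
  homogeneous_end p h.
Proof.
move=> hf hg hE r v rv; rewrite hE.
by apply: in_componentD; [apply: hf|apply: hg].
Qed.

Lemma homogeneous_endZ p c (f h : {linear V -> V}) :
  homogeneous_end p f -> h =1 c \*: f -> homogeneous_end p h.
Proof. by move=> hf hE r v rv; rewrite hE; apply: in_componentZ; apply: hf. Qed.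

Lemma homogeneous_combine (I : finType) (parity : I -> bool) g :
    (forall i, homogeneous_end (parity i) (g i)) ->
  forall p x, homogeneous parity p x ->
  homogeneous_end p (combine g x : {linear V -> V}).
Proof.
move=> hg p x hx q v qv; rewrite /= /combine.
elim/big_ind: _ => [|u w|i _]; first by case: (p (+) q).
  exact: in_componentD.
have [->|/hx <-] := eqVneq (x i) 0; last by apply/in_componentZ/hg.
by rewrite scale0r; case: (p (+) q).
Qed.

Lemma homogeneous_basis_vec (I : finType) (parity : I -> bool) i :
  homogeneous parity (parity i) (basis_vec K i).
Proof.
by move=> j; rewrite ffunE; case: (eqVneq j i) => [->|_] /=; rewrite ?eqxx.
Qed.

End Homogeneous.

Section Correspondence.
Variables (K : fieldType) (V0 V1 : lmodType K).
Hypothesis two_neq0 : (2 : K) != 0.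
Let V : lmodType K := (V0 * V1)%type.

(** * Representations built from two odd operators subject to the cubic relations *)

Section FromOddPair.
Variables A B : {linear V -> V}.
Hypotheses (odd_A : homogeneous_end true A) (odd_B : homogeneous_end true B).
Hypothesis AAB : forall v, A (A (B v)) = A v + B (A (A v)).
Hypothesis ABB : forall v, A (B (B v)) = B v + B (B (A v)).

Definition osp_family (i : osp_basis) : {linear V -> V} :=
  match i with
  | osp_E => A \o A
  | osp_F => \- (B \o B)
  | osp_H => \- ((A \o B) \+ (B \o A))
  | osp_A => A
  | osp_B => B
  end.

(** The factor for [asl_eps] is forced: a.b = eps/2 gives eps = 2(ab - ba), which is (AB - BA)/2
    when a = A/2 and b = B/2. *)
Definition asl2_family (i : asl2_basis) : {linear V -> V} :=
  match i with
  | asl_eps => 2^-1 \*: ((A \o B) \- (B \o A))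
  | asl_a => 2^-1 \*: A
  | asl_b => 2^-1 \*: B
  end.

Lemma osp_family_homogeneous i : homogeneous_end (osp_parity i) (osp_family i).
Proof.
case: i => /=.
- exact: (homogeneous_end_comp odd_A odd_A).
- apply: (@homogeneous_endZ _ _ _ _ (-1) (B \o B)) => [|v /=]; last first.
    by rewrite scaleN1r.
  exact: (homogeneous_end_comp odd_B odd_B).
- apply: (@homogeneous_endZ _ _ _ _ (-1) ((A \o B) \+ (B \o A))) => [|v /=];
    last by rewrite scaleN1r.
  apply: (@homogeneous_endD _ _ _ _ (A \o B) (B \o A)) => //.
    exact: (homogeneous_end_comp odd_A odd_B).
  exact: (homogeneous_end_comp odd_B odd_A).
- exact: odd_A.
- exact: odd_B.
Qed.

Lemma osp_family_table i j v :
  combine osp_family (osp_table K i j) v =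
    osp_family i (osp_family j v)
    + (-1 * (-1) ^+ (osp_parity i && osp_parity j))
      *: osp_family j (osp_family i v).
Proof.
(* Both sides are super-antisymmetric in [i] and [j], so one order of each pair is enough. *)
wlog: i j / (osp_basis_code i <= osp_basis_code j)%N.
  move=> wl.
  have [/wl //|/ltnW/wl ji] := leqP (osp_basis_code i) (osp_basis_code j).
  have -> : osp_table K i j =
      (-1 * (-1) ^+ (osp_parity i && osp_parity j)) *: osp_table K j i.
    by case: i j {ji} => [] [] /=;
      rewrite ?mulN1r ?opprK ?scale1r ?scaleN1r ?oppr0 ?opprK.
  rewrite combineZ ji andbC scalerDr scalerA addrC !mulN1r mulrNN -expr2.
  by rewrite sqrr_sign scale1r.
have [AN AD] : {morph A : u / - u} * {morph A : u w / u + w}.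
  by split; [exact: linearN | exact: linearD].
have [BN BD] : {morph B : u / - u} * {morph B : u w / u + w}.
  by split; [exact: linearN | exact: linearD].
case: i j => [] [] //= _;
  rewrite ?(combineN, combineZ, combine0, combine_basis) /=
          ?mulN1r ?expr1 ?expr0 ?opprK ?scale1r ?scaleN1r
          ?subrr ?addrN ?scaler_nat ?mulr2n //;
  (* The cubic relations serve as rewriting rules AAB -> A + BAA and ABB -> B + BBA. For instance
     AABB becomes AB + BA + BBAA, which is [E,F] = H. *)
  do ?[rewrite AN | rewrite AD | rewrite BN | rewrite BD
      | rewrite AAB | rewrite ABB];
  rewrite ?opprK ?opprD ?opprK //.
- by rewrite addrA subrK.
- by rewrite addrACA !subrK.
- by rewrite addrK.
- by rewrite [RHS]addrC addrACA !subrK.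
- by rewrite addrC addrK.
- by rewrite addNr.
- by rewrite -opprD [RHS]addrC -[X in X - _]addrA [B _ + _]addrC addrK.
- by rewrite addrA !subrK.
Qed.

Lemma asl2_family_homogeneous i :
  homogeneous_end (asl2_parity i) (asl2_family i).
Proof.
case: i => /=.
- apply: (@homogeneous_endZ _ _ _ _ 2^-1 ((A \o B) \- (B \o A))) => //.
  apply: (@homogeneous_endD _ _ _ _ (A \o B) (-1 \*: (B \o A))) => [||v /=].
  + exact: (homogeneous_end_comp odd_A odd_B).
  + apply: (@homogeneous_endZ _ _ _ _ (-1) (B \o A)) => //.
    exact: (homogeneous_end_comp odd_B odd_A).
  + by rewrite scaleN1r.
- exact: (homogeneous_endZ odd_A).
- exact: (homogeneous_endZ odd_B).
Qed.

Let P v := A (B v) - B (A v).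
Hypothesis P_idem : forall v, P (P v) = P v.

Lemma asl2_family_table i j v :
  combine asl2_family (asl2_table K i j) v =
    asl2_family i (asl2_family j v)
    + (1 * (-1) ^+ (asl2_parity i && asl2_parity j))
      *: asl2_family j (asl2_family i v).
Proof.
have [AN AZ] : {morph A : u w / u - w} * (forall c u, A (c *: u) = c *: A u).
  by split; [exact: linearB | move=> *; exact: linearZ].
have [BN BZ] : {morph B : u w / u - w} * (forall c u, B (c *: u) = c *: B u).
  by split; [exact: linearB | move=> *; exact: linearZ].
have two2 (u : V) : 2^-1 *: (u + u) = u.
  by rewrite scalerDr -scalerDl -[X in X + X]mul1r -mulrDl mulfV ?scale1r.
have PZ c u : P (c *: u) = c *: P u by rewrite /P !AZ !BZ !AZ scalerBr.
(* The terms ABA cancel, leaving AAB - BAA = A; likewise BAB cancels in [PB], leaving ABB - BBA =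
   B. *)
have PA u : A (P u) + P (A u) = A u.
  by rewrite /P AN AAB addrA subrK addrK.
have PB u : B (P u) + P (B u) = B u.
  by rewrite /P BN ABB addrC addrA subrK addrK.
case: i j => [] [] /=;
  rewrite ?(combineN, combineZ, combine0, combine_basis) /=
          -/(P _) ?mul1r ?expr1 ?expr0 ?scale1r ?scaleN1r ?subrr //
          -?/(P _) ?PZ ?AZ ?BZ ?P_idem -?scalerDr -?scalerBr ?PA ?PB //.
- by rewrite two2.
- by rewrite addrC PA.
- by rewrite addrC PB.
- by rewrite -!scalerN opprB.
Qed.

(** Kept transparent, so that the action of a basis vector unfolds to [combine] later on. *)
Definition osp_of_odd : osp_rep V0 V1.
Proof.
refine (@OspRep K V0 V1 (fun x => combine osp_family x) _ _ _).
- exact: combine_linear.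
- exact: homogeneous_combine osp_family_homogeneous.
- move=> p q x y hx hy v.
  apply: (etrans (combine_table osp_family_table hx hy v)).
  by rewrite mulN1r scaleNr.
Defined.

Definition asl2_of_odd : asl2_rep V0 V1.
Proof.
refine (@Asl2Rep K V0 V1 (fun x => combine asl2_family x) _ _ _).
- exact: combine_linear.
- exact: homogeneous_combine asl2_family_homogeneous.
- move=> p q x y hx hy v.
  apply: esym (etrans (combine_table asl2_family_table hx hy v) _).
  by rewrite mul1r.
Defined.

End FromOddPair.

(** * Representations in terms of their generators *)

Lemma osp_gen_table (rho : osp_rep V0 V1) i j v :
  combine (osp_gen rho) (osp_table K i j) v =
    osp_gen rho i (osp_gen rho j v)
    - (-1) ^+ (osp_parity i && osp_parity j)
      *: osp_gen rho j (osp_gen rho i v).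
Proof.
have := osp_act_bracket rho (@homogeneous_basis_vec K _ osp_parity i)
  (@homogeneous_basis_vec K _ osp_parity j) v.
rewrite /osp_bracket bilinear_extension_basis.
by rewrite (linear_combine _ _ (osp_act_linear rho)).
Qed.

Lemma asl2_gen_table (chi : asl2_rep V0 V1) i j v :
  combine (asl2_gen chi) (asl2_table K i j) v =
    asl2_gen chi i (asl2_gen chi j v)
    + (-1) ^+ (asl2_parity i && asl2_parity j)
      *: asl2_gen chi j (asl2_gen chi i v).
Proof.
have := asl2_act_mul chi (@homogeneous_basis_vec K _ asl2_parity i)
  (@homogeneous_basis_vec K _ asl2_parity j) v.
rewrite /asl2_mul bilinear_extension_basis => ->.
by rewrite (linear_combine _ _ (asl2_act_linear chi)).
Qed.

(** By linearity the generators determine the action, and the other fields of the record are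
    propositions. *)
Lemma osp_rep_ext (rho sigma : osp_rep V0 V1) :
  (forall i, osp_gen rho i =1 osp_gen sigma i) -> rho = sigma.
Proof.
case: rho sigma => [f fl fe fb] [g gl ge gb] fg.
have E : f = g.
  apply/funext => x; apply: linear_ext => v.
  rewrite (linear_combine _ _ fl) (linear_combine _ _ gl).
  by apply: eq_bigr => i _; congr (_ *: _); apply: fg.
by subst g; congr OspRep; apply: Prop_irrelevance.
Qed.

Lemma asl2_rep_ext (chi psi : asl2_rep V0 V1) :
  (forall i, asl2_gen chi i =1 asl2_gen psi i) -> chi = psi.
Proof.
case: chi psi => [f fl fe fb] [g gl ge gb] fg.
have E : f = g.
  apply/funext => x; apply: linear_ext => v.
  rewrite (linear_combine _ _ fl) (linear_combine _ _ gl).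
  by apply: eq_bigr => i _; congr (_ *: _); apply: fg.
by subst g; congr Asl2Rep; apply: Prop_irrelevance.
Qed.

Lemma osp_gen_odd (rho : osp_rep V0 V1) i :
  osp_parity i -> homogeneous_end true (osp_gen rho i).
Proof. by move=> <-; apply/osp_act_even/homogeneous_basis_vec. Qed.

(** Recovers E and F from [A,A] = 2E and [B,B] = -2F. *)
Lemma double_inj (u w : V) : u + u = w + w -> u = w.
Proof.
have two (x : V) : x + x = 2 *: x by rewrite scaler_nat mulr2n.
by rewrite !two => /(scalerI two_neq0).
Qed.

(** * Relations forced on A and B by an osp(1|2)-representation *)

Section OspRelations.
Variable rho : osp_rep V0 V1.
Let A := osp_gen rho osp_A.
Let B := osp_gen rho osp_B.

Lemma osp_genE v : osp_gen rho osp_E v = A (A v).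
Proof.
apply: double_inj; have := osp_gen_table rho osp_A osp_A v.
by rewrite combineZ combine_basis expr1 scaleN1r opprK scaler_nat mulr2n.
Qed.

Lemma osp_genF v : osp_gen rho osp_F v = - B (B v).
Proof.
apply: oppr_inj; rewrite opprK.
apply: double_inj; have := osp_gen_table rho osp_B osp_B v.
rewrite combineN combineZ combine_basis expr1 scaleN1r opprK => <-.
by rewrite scaler_nat mulr2n opprD.
Qed.

Lemma osp_genH v : osp_gen rho osp_H v = - (A (B v) + B (A v)).
Proof.
apply: oppr_inj; rewrite opprK; have := osp_gen_table rho osp_A osp_B v.
by rewrite combineN combine_basis expr1 scaleN1r opprK.
Qed.

(** This is [E,B] = A with E = A^2 substituted; [osp_gen_ABB] is [F,A] = B with F = -B^2. *)
Lemma osp_gen_AAB v : A (A (B v)) = A v + B (A (A v)).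
Proof.
have := osp_gen_table rho osp_E osp_B v.
rewrite combine_basis expr0 scale1r !osp_genE -/A -/B => AE.
by rewrite [X in X + _]AE subrK.
Qed.

Lemma osp_gen_ABB v : A (B (B v)) = B v + B (B (A v)).
Proof.
have := osp_gen_table rho osp_F osp_A v.
rewrite combine_basis expr0 scale1r !osp_genF -/A -/B => BE.
by rewrite [X in X + _]BE linearN opprK addrC addrA subrr add0r.
Qed.

Let P v := A (B v) - B (A v).

(** The operator P is linear, so the square of P - 1/2 expands as it does for numbers. Its constant
    term is the prescribed 1/4, which makes the ghost condition equivalent to idempotence of P. *)
Lemma ghost_casimir_sqr v :
  ghost_casimir rho (ghost_casimir rho v) = P (P v) - P v + 4^-1 *: v.
Proof.
have PB u w : P (u - w) = P u - P w.
  by rewrite /P !linearB /= !opprK addrACA.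
have PZ c u : P (c *: u) = c *: P u by rewrite /P !linearZ -!scalerDr.
have half (x : V) : 2^-1 *: x + 2^-1 *: x = x.
  by rewrite -scalerDr -mulr2n -scaler_nat scalerA mulVf ?scale1r.
rewrite /ghost_casimir -/A -/B -!/(P _) PB PZ.
rewrite [2^-1 *: (P v - _)]scalerBr scalerA -invfM -natrM.
by rewrite opprB [_ *: v - _]addrC addrA -[_ - _ - _]addrA -opprD half.
Qed.

Lemma ghost_casimir_idem :
  (forall v, ghost_casimir rho (ghost_casimir rho v) = 4^-1 *: v) <->
  (forall v, P (P v) = P v).
Proof.
split=> h v; last by rewrite ghost_casimir_sqr h subrr add0r.
apply/eqP; rewrite -subr_eq0; apply/eqP/(addIr (4^-1 *: v)).
by rewrite -ghost_casimir_sqr h add0r.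
Qed.

End OspRelations.

(** * Relations forced on A = 2a and B = 2b by an antialgebra representation *)

Section Asl2Relations.
Variable chi : asl2_rep V0 V1.
Let a := asl2_gen chi asl_a.
Let b := asl2_gen chi asl_b.
Let e := asl2_gen chi asl_eps.
Let A : {linear V -> V} := 2 \*: a.
Let B : {linear V -> V} := 2 \*: b.

(** From a.b = eps/2: AB - BA = 4(ab - ba) = 2 eps. *)
Lemma asl2_genP v : A (B v) - B (A v) = 2 *: e v.
Proof.
have := asl2_gen_table chi asl_a asl_b v.
rewrite combineZ combine_basis expr1 scaleN1r -/a -/b -/e => abE.
have aZ c u : a (c *: u) = c *: a u by exact: linearZ.
have bZ c u : b (c *: u) = c *: b u by exact: linearZ.
by rewrite /= aZ bZ -!scalerBr -abE !scalerA mulfK.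
Qed.

Lemma asl2_gen_odd i : asl2_parity i ->
  homogeneous_end true (2 \*: asl2_gen chi i : {linear V -> V}).
Proof.
move=> io; apply: (@homogeneous_endZ _ _ _ _ 2 (asl2_gen chi i)) => //.
by rewrite -io; apply/asl2_act_even/homogeneous_basis_vec.
Qed.

(** Since P = 2 eps and A = 2a, the product eps.a = a/2 reads AP + PA = A, and ABA cancels on
    expanding P. [asl2_gen_ABB] uses eps.b in the same way. *)
Lemma asl2_gen_AAB v : A (A (B v)) = A v + B (A (A v)).
Proof.
have := asl2_gen_table chi asl_eps asl_a v.
rewrite combineZ combine_basis expr0 scale1r -/a -/e => eaE.
have PA : A (A (B v) - B (A v)) + (A (B (A v)) - B (A (A v))) = A v.
  rewrite !asl2_genP /= !linearZ -!scalerDr addrC -eaE.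
  by rewrite [2 *: (2^-1 *: _)]scalerA mulfV ?scale1r.
by rewrite -[X in X + _]PA linearB -addrA subrK subrK.
Qed.

Lemma asl2_gen_ABB v : A (B (B v)) = B v + B (B (A v)).
Proof.
have := asl2_gen_table chi asl_eps asl_b v.
rewrite combineZ combine_basis expr0 scale1r -/b -/e => ebE.
have PB : (A (B (B v)) - B (A (B v))) + B (A (B v) - B (A v)) = B v.
  rewrite !asl2_genP /= !linearZ -!scalerDr -ebE.
  by rewrite [2 *: (2^-1 *: _)]scalerA mulfV ?scale1r.
by rewrite -[X in X + _]PB linearB -addrA subrK subrK.
Qed.

Let P v := A (B v) - B (A v).

(** The product eps.eps = eps reads 2 eps^2 = eps, hence P^2 = 4 eps^2 = 2 eps = P. *)
Lemma asl2_gen_P_idem v : P (P v) = P v.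
Proof.
have := asl2_gen_table chi asl_eps asl_eps v.
rewrite combine_basis expr0 scale1r -/e -mulr2n -scaler_nat => eE.
by rewrite /P !asl2_genP linearZ /= -eE.
Qed.

End Asl2Relations.

(** * The two maps and the proof that they are mutually inverse *)

Definition osp_of_asl2 (chi : asl2_rep V0 V1) : osp_rep V0 V1 :=
  osp_of_odd (@asl2_gen_odd chi asl_a isT) (@asl2_gen_odd chi asl_b isT)
    (@asl2_gen_AAB chi) (@asl2_gen_ABB chi).

Lemma osp_of_asl2_gen chi i v : osp_gen (osp_of_asl2 chi) i v =
  osp_family (2 \*: asl2_gen chi asl_a) (2 \*: asl2_gen chi asl_b) i v.
Proof. exact: combine_basis. Qed.

Lemma osp_of_asl2_ghost chi v :
  ghost_casimir (osp_of_asl2 chi) (ghost_casimir (osp_of_asl2 chi) v)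
  = 4^-1 *: v.
Proof.
move: v; apply/ghost_casimir_idem => v.
by rewrite !osp_of_asl2_gen; apply: asl2_gen_P_idem.
Qed.

Definition ghost_osp_of_asl2 chi : ghost_osp_rep V0 V1 :=
  exist _ (osp_of_asl2 chi) (osp_of_asl2_ghost chi).

Definition asl2_of_ghost_osp (rho : ghost_osp_rep V0 V1) : asl2_rep V0 V1 :=
  asl2_of_odd (@osp_gen_odd (sval rho) osp_A isT)
    (@osp_gen_odd (sval rho) osp_B isT)
    (@osp_gen_AAB (sval rho)) (@osp_gen_ABB (sval rho))
    (proj1 (ghost_casimir_idem (sval rho)) (svalP rho)).

Lemma asl2_of_ghost_osp_gen rho i v : asl2_gen (asl2_of_ghost_osp rho) i v =
  asl2_family (osp_gen (sval rho) osp_A) (osp_gen (sval rho) osp_B) i v.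
Proof. exact: combine_basis. Qed.

(** The odd generators are doubled and then halved, while eps returns as P/2 by [asl2_genP]. *)
Lemma ghost_osp_of_asl2K : cancel ghost_osp_of_asl2 asl2_of_ghost_osp.
Proof.
move=> chi; apply: asl2_rep_ext => i v; rewrite asl2_of_ghost_osp_gen.
by case: i => /=; rewrite !osp_of_asl2_gen ?asl2_genP /= scalerA mulVf ?scale1r.
Qed.

(** The odd generators are halved and then doubled; the even ones agree because the odd brackets
    express them through A and B in any representation. *)
Lemma asl2_of_ghost_ospK : cancel asl2_of_ghost_osp ghost_osp_of_asl2.
Proof.
move=> rho; apply: eq_sig_hprop => [?|]; first exact: Prop_irrelevance.
apply: osp_rep_ext => i v; rewrite -[proj1_sig _]/(osp_of_asl2 _).
have AE w : 2 *: asl2_gen (asl2_of_ghost_osp rho) asl_a w =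
    osp_gen (sval rho) osp_A w.
  by rewrite asl2_of_ghost_osp_gen /= scalerA mulfV ?scale1r.
have BE w : 2 *: asl2_gen (asl2_of_ghost_osp rho) asl_b w =
    osp_gen (sval rho) osp_B w.
  by rewrite asl2_of_ghost_osp_gen /= scalerA mulfV ?scale1r.
rewrite osp_of_asl2_gen.
by case: i => /=; rewrite ?AE ?BE ?(osp_genE, osp_genF, osp_genH).
Qed.

End Correspondence.

Theorem theorem1 (R : realType) (k : scalars) (V0 V1 : lmodType (ground R k)) :
  exists Phi : asl2_rep V0 V1 -> ghost_osp_rep V0 V1,
    bijective Phi /\
    forall chi : asl2_rep V0 V1,
      let A := osp_gen (sval (Phi chi)) osp_A in
      let B := osp_gen (sval (Phi chi)) osp_B in
      let E := osp_gen (sval (Phi chi)) osp_E in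
      let F := osp_gen (sval (Phi chi)) osp_F in
      let H := osp_gen (sval (Phi chi)) osp_H in
      forall v : (V0 * V1)%type,
        [/\ A v = 2 *: asl2_gen chi asl_a v,
            B v = 2 *: asl2_gen chi asl_b v,
            E v = A (A v),
            F v = - B (B v)
          & H v = - (A (B v) + B (A v))].
Proof.
(* Both possible ground fields have characteristic zero. *)
have two_neq0 : (2 : ground R k) != 0.
  by case: k {V0 V1} => /=; rewrite pnatr_eq0.
exists (ghost_osp_of_asl2 two_neq0 (V0 := V0) (V1 := V1)); split.
  exists (asl2_of_ghost_osp two_neq0 (V0 := V0) (V1 := V1)).
    exact: ghost_osp_of_asl2K.
  exact: asl2_of_ghost_ospK.
(* The formulas hold by construction: they are the branches of [osp_family]. *)
by move=> chi A B E F H v; split; rewrite /A /B /E /F /H !osp_of_asl2_gen.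
Qed.
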